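(* Let $n\ge 2w\ge 2$ and $e\ge 2$ be integers. If $\mathcal C$ is a nontrivial $e$-perfect code in $J(n,w)$, then $\mathcal C$ is $\bigl(w-\lfloor e\sqrt{w}\rfloor\bigr)$-regular.
   Context: The Johnson scheme $J(n,w)$ has as elements all $w$-subsets of $[n]=\{1,\dots,n\}$, with distance $d(X,Y)=|X\setminus Y|$. The $e$-ball centred at $X$ is the set of $w$-subsets at distance at most $e$ from $X$. An $e$-perfect code in $J(n,w)$ is a set $\mathcal C$ of $w$-subsets such that the $e$-balls centred at the elements of $\mathcal C$ partition the set of all $w$-subsets of $[n]$. It is trivial if $e=0$, or $|\mathcal C|=1$, or $n=2w$, $w=2e+1$ and $\mathcal C$ consists of a $w$-subset and its complement; otherwise it is nontrivial. For $A\subseteq[n]$ and $I\subseteq A$ put $\mathcal C_A(i)=|\{c\in\mathcal C: |c\cap A|=i\}|$ and $\mathcal C_A(I)=|\{c\in\mathcal C: c\cap A=I\}|$. The code $\mathcal C$ is $t$-regular if both of the following hold: (c.1) there exist numbers $\alpha(0),\dots,\alpha(t)$ such that for every $A\subset[n]$ with $|A|=t$, $\mathcal C_A(i)=\alpha(i)$ for all $0\le i\le t$; (c.2) for every $t$-subset $A$ of $[n]$ there exist numbers $\beta_A(0),\dots,\beta_A(t)$ such that $\mathcal C_A(I)=\beta_A(|I|)$ for all $I\subseteq A$. *)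

(* Defs.v *)
From mathcomp Require Import all_boot.

Set Implicit Arguments.
Unset Strict Implicit.
Unset Printing Implicit Defensive.

(* The ground set [n] = {1, .., n} is represented by 'I_n. *)

Definition johnson (n w : nat) : {set {set 'I_n}} :=
  [set X : {set 'I_n} | #|X| == w].

(* This is symmetric, and a distance, only between sets of equal size. *)
Definition jdist (n : nat) (X Y : {set 'I_n}) : nat := #|X :\: Y|.

Definition jball (n w e : nat) (X : {set 'I_n}) : {set {set 'I_n}} :=
  [set Y in johnson n w | jdist X Y <= e].

(* The balls are a family indexed by the codewords: two distinct codewords   *)
(* with equal balls are excluded, which finset's partition predicate applied *)
(* to the set of all balls would not ensure.                                 *)
Definition perfect_code (n w e : nat) (C : {set {set 'I_n}}) : Prop :=
  [/\ C \subset johnson n w,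
      \bigcup_(c in C) jball w e c = johnson n w
    & {in C &, forall c d, c != d -> [disjoint jball w e c & jball w e d]}].

Definition trivial_code (n w e : nat) (C : {set {set 'I_n}}) : Prop :=
  [\/ e = 0, #|C| = 1
    | [/\ n = 2 * w, w = 2 * e + 1
        & exists2 X : {set 'I_n}, X \in johnson n w & C = [set X; ~: X]]].

Definition card_meet (n : nat) (C : {set {set 'I_n}}) (A : {set 'I_n})
    (i : nat) : nat :=
  #|[set c in C | #|c :&: A| == i]|.

Definition trace_meet (n : nat) (C : {set {set 'I_n}}) (A I : {set 'I_n}) : nat :=
  #|[set c in C | c :&: A == I]|.

(* Only the values alpha 0, .., alpha t and beta 0, .., beta t matter. *)
Definition regular_code (n t : nat) (C : {set {set 'I_n}}) : Prop :=
  (exists alpha : nat -> nat,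
     forall A : {set 'I_n}, #|A| = t ->
     forall i : nat, i <= t -> card_meet C A i = alpha i)
  /\ (forall A : {set 'I_n}, #|A| = t ->
      exists beta : nat -> nat,
        forall I : {set 'I_n}, I \subset A -> trace_meet C A I = beta #|I|).

(* Main.v *)
Require Import Defs.
From mathcomp Require Import all_boot all_order all_algebra.
From mathcomp Require Import zify ring.

(** Write B for the matrix of the relation that two w-sets are at distance at
    most e, and s for the size of an e-ball.  For an e-perfect code C the
    function f = s 1_C - 1 on the w-sets satisfies B f = 0.  The eigenvalues of
    B on the nonconstant harmonic spaces of the Johnson scheme are, for
    1 <= k <= w,
      Phi(k) = sum_j (-1)^j C(k-1,j) C(w-k,e-j) C(n-w-k,e-j),
    and s is the eigenvalue on constants.  If Phi(1), .., Phi(t) are all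
    nonzero, then f has no component of degree at most t, which amounts to: for
    every t-set A and every I inside A, the sum D(A,I) of f over the w-sets
    that meet A in I vanishes.  Hence s |{c in C : c meets A in I}| is the
    number C(n-t,w-|I|) of all such w-sets, which depends on |I| only, and C is
    t-regular ([regular_of_trace]).

    The passage from B f = 0 to D(A,I) = 0 is elementary
    ([trace_sum_eq0]), by induction on k = |A|.  The sets A minus a point
    are already dealt with, so adding a point to I changes the sign of D(A,I)
    and D(A,I) = (-1)^|A - I| D(A,A) ([trace_sum_sign]).  Summing (B f)(X) = 0
    over all X containing A gives D(A,A) times a signed sum of ball counts, and
    that signed sum is Phi(k) ([ball_eigenvalue]).  It is computed with the
    generating function of the w-sets X containing A, marked by |X| and
    by |X meet Y|: the signs collapse it to
      (v-1)^k (1+uv)^(w-k) (1+u)^(n-w-k),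
    and summing coefficients over the powers v^m with m >= w-e, as the ball
    condition asks, divides by one factor v-1, whence the k-1 in Phi(k).

    Finally Phi(k) > 0 when w-k >= floor(e sqrt w) ([lloyd_sum_gt0]).  The ratio
    of two consecutive terms is
      (k-1-j)(e-j)^2 / ((j+1)(w-k-e+j+1)(n-w-k-e+j+1)),
    largest at j = 0, where it is below 1 as soon as (k-1)e^2 < (w-k-e+1)^2
    (recall n >= 2w).  With q = w-k+1 > e sqrt w this is (w-q)e^2 < (q-e)^2,
    which follows from e^2 w < q^2 because 2eq <= e^2 q when e >= 2.  So Phi(k)
    is an alternating sum of decreasing terms. *)

Set Implicit Arguments.
Unset Strict Implicit.
Unset Printing Implicit Defensive.

Import Order.TTheory GRing.Theory Num.Theory.
Local Open Scope ring_scope.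

(** * Positivity of the eigenvalues *)

Lemma altsum_bounds m (T : nat -> nat) :
  (forall j, (j.+1 < m)%N -> (T j.+1 <= T j)%N) ->
  0 <= (\sum_(j < m) (-1) ^+ j * (T j)%:R : int) <= (T 0)%:R.
Proof.
elim: m T => [|m IHm] T decT; first by rewrite big_ord0 lexx ler0n.
rewrite big_ord_recl expr0 mul1r.
under eq_bigr => j _ do rewrite lift0 exprS mulN1r mulNr.
rewrite sumrN subr_ge0 gerBl.
have /andP[-> leT1] :
    0 <= (\sum_(j < m) (-1) ^+ j * (T j.+1)%:R : int) <= (T 1)%:R.
  by apply: (IHm (fun j => T j.+1)) => j ltjm; apply: decT.
case: m => [|m] in IHm decT leT1 *; first by rewrite big_ord0 ler0n.
by rewrite andbT (le_trans leT1) // ler_nat decT.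
Qed.

Lemma altsum_gt0 m (T : nat -> nat) :
  (forall j, (j < m)%N -> (T j.+1 <= T j)%N) -> (T 1 < T 0)%N ->
  0 < (\sum_(j < m.+1) (-1) ^+ j * (T j)%:R : int).
Proof.
move=> decT ltT10; rewrite big_ord_recl expr0 mul1r.
under eq_bigr => j _ do rewrite lift0 exprS mulN1r mulNr.
rewrite sumrN subr_gt0.
have /andP[_ leT1] :
    0 <= (\sum_(j < m) (-1) ^+ j * (T j.+1)%:R : int) <= (T 1)%:R.
  by apply: (@altsum_bounds m (fun j => T j.+1)) => j ltjm; apply: decT.
by rewrite (le_lt_trans leT1) // ltr_nat.
Qed.

Definition lloyd_term (k a b e j : nat) : nat :=
  ('C(k, j) * 'C(a, e - j) * 'C(b, e - j))%N.

(** [lloyd_sum k.-1 (w - k) (n - w - k) e] is the eigenvalue of the e-ball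
    relation of J(n,w) on the k-th harmonic space, for k > 0. *)
Definition lloyd_sum (k a b e : nat) : int :=
  \sum_(j < e.+1) (-1) ^+ j * (lloyd_term k a b e j)%:R.

Lemma lloyd_term_ratio k a b e j : (j < e)%N -> (e <= a)%N -> (e <= b)%N ->
  (j.+1 * (a - e + j.+1) * (b - e + j.+1) * lloyd_term k a b e j.+1
   = (k - j) * (e - j) ^ 2 * lloyd_term k a b e j)%N.
Proof.
move=> lt_je le_ea le_eb; rewrite /lloyd_term.
have step c : (e <= c)%N ->
    ((c - e + j.+1) * 'C(c, e - j.+1) = (e - j) * 'C(c, e - j))%N.
  move=> le_ec; have <- : (e - j.+1).+1 = (e - j)%N by lia.
  by rewrite mul_bin_left; congr (_ * _)%N; lia.
transitivity ((j.+1 * 'C(k, j.+1)) * ((a - e + j.+1) * 'C(a, e - j.+1))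
              * ((b - e + j.+1) * 'C(b, e - j.+1)))%N; first by ring.
by rewrite mul_bin_left !step //; ring.
Qed.

Lemma lloyd_sum_gt0 k a b e : (0 < e <= a)%N -> (a <= b)%N ->
  (k * e ^ 2 < (a - e).+1 ^ 2)%N -> 0 < lloyd_sum k a b e.
Proof.
move=> /andP[e_gt0 le_ea] le_ab small_k; have le_eb := leq_trans le_ea le_ab.
(* From j = 0 on, the left-hand side decreases and the right-hand side grows. *)
have step j :
    ((k - j) * (e - j) ^ 2 < j.+1 * (a - e + j.+1) * (b - e + j.+1))%N.
  apply: (@leq_ltn_trans (k * e ^ 2)).
    by rewrite leq_mul ?leq_sqr ?leq_subr.
  apply: (leq_trans small_k); rewrite -mulnA -[leqLHS]mul1n leq_mul // -mulnn.
  by apply: leq_mul; lia.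
have pos j : (0 < j.+1 * (a - e + j.+1) * (b - e + j.+1))%N.
  exact: leq_ltn_trans (step j).
apply: altsum_gt0 => [j lt_je|].
  by rewrite -(leq_pmul2l (pos j)) lloyd_term_ratio // leq_mul // ltnW.
rewrite -(ltn_pmul2l (pos 0)) lloyd_term_ratio // ltn_mul2r step andbT.
by rewrite /lloyd_term bin0 mul1n muln_gt0 !bin_gt0 !subn0 le_ea.
Qed.

(** Expanding the square, (w - q) e^2 < (q - e)^2 says that
    e^2 w + 2 e q < q^2 + e^2 q + e^2, and e >= 2 gives 2 e q <= e^2 q. *)
Lemma sqr_bound e w q : (2 <= e)%N -> (e < q)%N -> (e ^ 2 * w < q ^ 2)%N ->
  ((w - q) * e ^ 2 < (q - e) ^ 2)%N.
Proof.
move=> le2e lt_eq lt_w; case: (leqP w q) => [le_wq | lt_qw].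
  by rewrite (eqP le_wq) mul0n expn_gt0 subn_gt0 lt_eq.
have [c def_q] : exists c, q = (c + e)%N.
  by exists (q - e)%N; rewrite subnK // ltnW.
have [d def_w] : exists d, w = (d + q)%N.
  by exists (w - q)%N; rewrite subnK // ltnW.
move: lt_w; rewrite {}def_w {}def_q !addnK => lt_d.
have le1 : (2 * c * e <= e ^ 2 * c)%N by nia.
have le2 : (e ^ 2 <= e ^ 2 * e)%N by nia.
nia.
Qed.

Lemma truncn_sqrt_bound (R : archiRcfType) (e w : nat) :
  (e ^ 2 * w < (Num.truncn (e%:R * Num.sqrt (w%:R : R))).+1 ^ 2)%N.
Proof.
have lt_x := truncnS_gt (e%:R * Num.sqrt (w%:R : R)).
rewrite -ltr_sqr ?nnegrE ?mulr_ge0 ?sqrtr_ge0 ?ler0n // in lt_x.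
by rewrite exprMn sqr_sqrtr ?ler0n // -!natrX -natrM ltr_nat in lt_x.
Qed.

Lemma truncn_sqrt_ge (R : archiRcfType) (e w : nat) : (0 < w)%N ->
  (e <= Num.truncn (e%:R * Num.sqrt (w%:R : R)))%N.
Proof.
move=> w_gt0; rewrite truncn_ge_nat ?mulr_ge0 ?sqrtr_ge0 ?ler0n //.
by rewrite -[leLHS]mulr1 ler_wpM2l // -[leLHS]sqrtr1 ler_wsqrtr // ler1n.
Qed.

(** * Generating functions of families of subsets *)

Lemma coef_exp1DCX (R : comNzRingType) (c : R) m i :
  ((1 + c%:P * 'X) ^+ m)`_i = c ^+ i *+ 'C(m, i).
Proof.
rewrite exprDn coef_sum.
under eq_bigr => j _ do
  rewrite expr1n mul1r coefMn exprMn -rmorphXn /= coefCM coefXn.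
have [lt_im | lt_mi] := ltnP i m.+1; last first.
  rewrite bin_small // big1 // => j _.
  by rewrite gtn_eqF ?mulr0 ?mul0rn // (leq_trans (ltn_ord j)).
rewrite (bigD1 (Ordinal lt_im)) //= eqxx mulr1 big1 ?addr0 // => j neq_ji.
by rewrite eq_sym (inj_eq val_inj j (Ordinal lt_im)) (negPf neq_ji) mulr0 mul0rn.
Qed.

(** Expand the product of F x + [x \notin A]: a set that misses a point of A
    contributes a zero factor. *)
Lemma sum_supersets (R : comPzRingType) (T : finType) (A : {set T}) (F : T -> R) :
  \sum_(X : {set T} | A \subset X) \prod_(x in X) F x
  = \prod_(x in A) F x * \prod_(x in ~: A) (1 + F x).
Proof.
transitivity (\prod_x (F x + (if x \in A then 0 else 1))).
  rewrite bigA_distr big_mkcond /=; apply: eq_bigr => X _.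
  case: ifPn => [/subsetP sAX | /subsetPn[x Ax X'x]].
    rewrite big_mkcond; apply: eq_bigr => x _.
    by case: ifPn => // X'x; rewrite ifN //; apply: contraNN X'x; apply: sAX.
  by rewrite (bigD1 x) //= (negPf X'x) Ax mul0r.
rewrite (bigID (mem A)) /=; congr (_ * _).
  by apply: eq_bigr => x Ax; rewrite Ax addr0.
by apply: eq_big => x; rewrite ?inE // => /negPf->; rewrite addrC.
Qed.

Lemma sum_subsets (R : comPzRingType) (T : finType) (A : {set T}) (x y : R) :
  \sum_(I : {set T} | I \subset A) x ^+ #|I| * y ^+ #|A :\: I| = (x + y) ^+ #|A|.
Proof.
transitivity (\prod_z ((if z \in A then x else 0) + (if z \in A then y else 1))).
  rewrite bigA_distr big_mkcond /=; apply: eq_bigr => I _.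
  case: ifPn => [/subsetP sIA | /subsetPn[z Iz A'z]]; last first.
    by rewrite (bigD1 z) //= Iz (negPf A'z) mul0r.
  rewrite (bigID (mem I)) /= -!prodr_const; congr (_ * _).
    by apply: eq_bigr => z Iz; rewrite Iz sIA.
  rewrite big_mkcond /= [RHS]big_mkcond; apply: eq_bigr => z _.
  by rewrite inE; case: (z \in I); case: (z \in A).
rewrite (bigID (mem A)) /= [X in _ * X]big1 ?mulr1 => [|z /negPf->]; last first.
  by rewrite add0r.
by rewrite -prodr_const; apply: eq_bigr => z ->.
Qed.

(** * Counting a ball above a given set *)

Definition topsum (lo hi : nat) (p : {poly int}) : int :=
  \sum_(lo <= i < hi) p`_i.

Lemma topsum_sum lo hi (I : finType) (P : pred I) (F : I -> {poly int}) :
  topsum lo hi (\sum_(i | P i) F i) = \sum_(i | P i) topsum lo hi (F i).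
Proof.
rewrite exchange_big; apply: eq_bigr => i _; exact: coef_sum.
Qed.

Lemma topsumZ lo hi c p : topsum lo hi (c *: p) = c * topsum lo hi p.
Proof. by rewrite mulr_sumr; apply: eq_bigr => i _; rewrite coefZ. Qed.

Lemma topsum_Xn lo hi m : (m < hi)%N -> topsum lo hi 'X^m = (lo <= m)%:R.
Proof.
move=> lt_mhi; rewrite /topsum; under eq_bigr => i _ do rewrite coefXn.
case: leqP => [le_lom | lt_mlo]; last first.
  rewrite big_nat big1 // => i /andP[le_loi _].
  by rewrite gtn_eqF // (leq_trans lt_mlo).
rewrite (bigD1_seq m) ?iota_uniq ?mem_index_iota ?le_lom //= eqxx big1 ?addr0 //.
by move=> i /negPf->.
Qed.

(** Telescoping: summing the top coefficients of a polynomial divides it by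
    X - 1 and reads off one coefficient. *)
Lemma topsum_mulXsub1 lo hi (q : {poly int}) : (lo < hi)%N ->
  (size q <= hi)%N -> topsum lo.+1 hi.+1 (('X - 1) * q) = q`_lo.
Proof.
move=> lt_lohi size_q; rewrite /topsum -[hi.+1]addn1 -[lo.+1]addn1 big_addn addnK.
under eq_bigr => i _ do
  rewrite mulrBl mul1r coefB coefXM addn1 /= -opprB.
rewrite sumrN telescope_sumr ?(ltnW lt_lohi) // opprB [q`_hi]nth_default //.
by rewrite subr0.
Qed.

(* The outer variable u marks the size of a set, the inner variable v the size
   of its intersection with a fixed set. *)
Local Notation u := ('X : {poly {poly int}}).
Local Notation v := ('X%:P : {poly {poly int}}).

Lemma supersets_gf (T : finType) (A Y : {set T}) :
  \sum_(X : {set T} | A \subset X) u ^+ #|X| * v ^+ #|X :&: Y|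
  = u ^+ #|A| * (v ^+ #|A :&: Y| *
      ((1 + v * u) ^+ #|Y :\: A| * (1 + u) ^+ #|~: (A :|: Y)|)).
Proof.
pose F (x : T) := u * (if x \in Y then v else 1).
have prodF (X : {set T}) : \prod_(x in X) F x = u ^+ #|X| * v ^+ #|X :&: Y|.
  rewrite big_split prodr_const -big_mkcondr prodr_const /=; congr (_ * _ ^+ _).
  by apply: eq_card => x; rewrite inE.
under eq_bigr => X _ do rewrite -prodF.
rewrite sum_supersets prodF -mulrA (bigID (mem Y)) /= -!prodr_const.
suff [-> ->] :
  \prod_(x in ~: A | x \in Y) (1 + F x) = \prod_(x in Y :\: A) (1 + v * u) /\
  \prod_(x in ~: A | x \notin Y) (1 + F x) = \prod_(x in ~: (A :|: Y)) (1 + u).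
  by [].
split; apply: eq_big => x; rewrite ?inE ?negb_or 1?andbC //.
  by case/andP=> Yx _; rewrite /F Yx mulrC.
by case/andP=> /negPf Y'x _; rewrite /F Y'x mulr1.
Qed.

(** With a = w - k and b = n - w - k, the polynomial in v that enumerates by
    |X :&: Y| the w-sets X that contain a given k-set A, when |A :&: Y| = i;
    the exponents a + (k - i) and b + i are the sizes of Y - A and of the
    complement of A and Y, and the k points of A use up the rest of u^w. *)
Definition meet_poly (a b k i : nat) : {poly int} :=
  (v ^+ i * ((1 + v * u) ^+ (a + (k - i)) * (1 + u) ^+ (b + i)))`_a.

Lemma meet_polyP n w (A Y : {set 'I_n}) : (2 * w <= n)%N -> (#|A| <= w)%N ->
    Y \in johnson n w ->
  \sum_(X in johnson n w | A \subset X) 'X^#|X :&: Y|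
  = meet_poly (w - #|A|) (n - w - #|A|) #|A| #|A :&: Y|.
Proof.
move=> le_2wn le_Aw; rewrite inE => /eqP card_Y.
have le_AY : (#|A :&: Y| <= #|A|)%N by rewrite subset_leq_card ?subsetIl.
have card_YA : #|Y :\: A| = (w - #|A| + (#|A| - #|A :&: Y|))%N.
  by rewrite cardsD card_Y setIC; lia.
have card_AY : #|~: (A :|: Y)| = (n - w - #|A| + #|A :&: Y|)%N.
  rewrite cardsCs setCK card_ord cardsU card_Y.
  have : (#|A :&: Y| <= #|Y|)%N by rewrite subset_leq_card ?subsetIr.
  lia.
have := congr1 (fun p : {poly {poly int}} => p`_w) (supersets_gf A Y).
rewrite card_YA card_AY coefXnM ltnNge le_Aw /= /meet_poly => <-.
rewrite coef_sum [LHS]big_mkcond [RHS]big_mkcond /=; apply: eq_bigr => X _.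
rewrite inE andbC; case: (A \subset X) => //=.
rewrite -rmorphXn /= coefMC coefXn eq_sym.
by case: eqP => _; rewrite ?mul1r ?mul0r.
Qed.

(** The number of w-sets X that contain a given k-set A and are at distance at
    most e from a w-set Y with |A :&: Y| = i: being at distance at most e means
    meeting Y in at least w - e points. *)
Definition ball_count n w e (k i : nat) : int :=
  topsum (w - e) w.+1 (meet_poly (w - k) (n - w - k) k i).

Lemma ball_countP n w e (A Y : {set 'I_n}) : (2 * w <= n)%N -> (#|A| <= w)%N ->
    Y \in johnson n w ->
  \sum_(X in johnson n w | A \subset X) (jdist Y X <= e)%:R
  = ball_count n w e #|A| #|A :&: Y|.
Proof.
move=> le_2wn le_Aw JY; rewrite /ball_count -(meet_polyP le_2wn le_Aw JY) topsum_sum.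
apply: eq_bigr => X /andP[]; rewrite !inE in JY * => /eqP card_X _.
have le_XY : (#|X :&: Y| <= #|X|)%N by rewrite subset_leq_card ?subsetIl.
rewrite topsum_Xn; last by rewrite ltnS -card_X.
by rewrite /jdist cardsD (eqP JY) setIC leq_subCl.
Qed.

(** By the binomial theorem the signed sum over I turns the factors
    v^|I| (1+uv)^|A - I| (1+u)^|I| into
    (v(1+u) - (1+uv))^|A| = (v-1)^|A|. *)
Lemma signed_meet_poly (T : finType) a b (A : {set T}) :
  \sum_(I : {set T} | I \subset A)
     (-1) ^+ #|A :\: I| *: meet_poly a b #|A| #|I|
  = ('X - 1) ^+ #|A| * \sum_(r < a.+1) 'X^r *+ ('C(a, r) * 'C(b, a - r)).
Proof.
transitivity ((('X - 1) ^+ #|A|)%:P * ((1 + v * u) ^+ a * (1 + u) ^+ b))`_a.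
  have -> : (('X - 1) ^+ #|A|)%:P = (v * (1 + u) - (1 + v * u)) ^+ #|A|.
    by rewrite rmorphXn rmorphB rmorph1; congr (_ ^+ _); ring.
  rewrite -sum_subsets mulr_suml coef_sum; apply: eq_bigr => I sIA.
  rewrite cardsD (setIidPr sIA) -mul_polyC -coefCM; congr (_`_ _).
  rewrite [(v * _) ^+ _]exprMn [(- (1 + _)) ^+ _]exprNn !exprD.
  have -> : (((-1) ^+ (#|A| - #|I|))%:P)%:P
      = (-1) ^+ (#|A| - #|I|) :> {poly {poly int}}.
    by rewrite !rmorphXn /= !rmorphN1.
  have mulE (R : comPzRingType) (s x p q r t : R) :
    s * (x * (p * q * (r * t))) = x * t * (s * q) * (p * r) by ring.
  by rewrite mulE.
rewrite coefCM coefM; congr (_ * _); apply: eq_bigr => r _.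
have := coef_exp1DCX (1 : {poly int}) b (a - r); rewrite mul1r expr1n => ->.
by rewrite coef_exp1DCX mulr_natr -mulrnA.
Qed.

Lemma topsum_Xsub1_exp k lo hi m : (0 < k)%N -> (lo < hi)%N -> (m + k <= hi)%N ->
  topsum lo.+1 hi.+1 (('X - 1) ^+ k * 'X^m)
  = if (m <= lo)%N then (-1) ^+ (m + k.-1 - lo) * 'C(k.-1, lo - m)%:R else 0.
Proof.
case: k => // k _ lt_lohi; rewrite exprS -mulrA => le_mk.
rewrite topsum_mulXsub1 //; last first.
  have -> : 'X - 1 = 'X - 1%:P :> {poly int} by [].
  rewrite (leq_trans (size_polyMleq _ _)) // size_exp_XsubC size_polyXn; lia.
rewrite coefMXn ltnNge; case: leqP => //= le_m_lo.
have -> : ('X - 1) ^+ k = (-1) ^+ k *: (1 + (-1)%:P * 'X) ^+ k :> {poly int}.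
  rewrite -exprZn; congr (_ ^+ _); rewrite scalerDr mul_polyC scalerA mulrNN mul1r.
  by rewrite scale1r scaleN1r addrC.
rewrite coefZ coef_exp1DCX.
have [le_lomk|lt] := leqP (lo - m) k; last by rewrite bin_small // !mulr0n !mulr0.
rewrite -mulr_natr mulrA -exprD; congr (_ * _).
rewrite -[LHS]signr_odd -[RHS]signr_odd; congr (_ ^+ _).
have -> : (m + k.+1.-1 - lo = k - (lo - m))%N by move: le_m_lo le_lomk; clear; lia.
by rewrite oddD (oddB le_lomk).
Qed.

(** The signed sum has left (v-1)^k times the coefficient of u^a in
    (1+uv)^a (1+u)^b; the ball condition then replaces (v-1)^k by (v-1)^(k-1),
    from which a single coefficient is read off for each power of v. *)
Lemma ball_eigenvalue (T : finType) n w e (A : {set T}) :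
    (0 < #|A| <= w)%N -> (e <= w - #|A|)%N ->
  \sum_(I : {set T} | I \subset A)
     (-1) ^+ #|A :\: I| * ball_count n w e #|A| #|I|
  = lloyd_sum #|A|.-1 (w - #|A|) (n - w - #|A|) e.
Proof.
move=> /andP[A_gt0 le_Aw] le_ea; rewrite /ball_count.
have := subnK le_Aw.
move: (w - #|A|)%N (n - w - #|A|)%N le_ea => a b le_ea <-.
under eq_bigr => I _ do rewrite -topsumZ.
rewrite -topsum_sum signed_meet_poly mulr_sumr topsum_sum.
have -> : (a + #|A| - e = (a - e + #|A|.-1).+1)%N by lia.
(* Here r = a - m for the power v^m taken from (1+uv)^a, so that j = e - r. *)
transitivity (\sum_(r < a.+1) (if (r <= e)%N then
   (-1) ^+ (e - r) * ('C(#|A|.-1, e - r) * 'C(a, r) * 'C(b, r))%:R else 0 : int)).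
  rewrite (reindex_inj rev_ord_inj) /=; apply: eq_bigr => r _.
  rewrite subSS -scaler_nat -scalerAr topsumZ.
  rewrite topsum_Xsub1_exp //; [|lia|have := ltn_ord r; lia].
  have le_ra : (r <= a)%N by rewrite -ltnS.
  rewrite bin_sub // subKn //.
  have [le_re|lt_er] := leqP r e; last first.
    case: ifP; rewrite ?mulr0 // => _.
    rewrite ['C(_.-1, _)]bin_small ?mulr0 //; lia.
  case: ifPn => [le_a|]; last first.
    move=> gt_a; rewrite [X in (X * _ * _)%N]bin_small ?mul0n ?mulr0 //; lia.
  have -> : (a - r + #|A|.-1 - (a - e + #|A|.-1) = e - r)%N by lia.
  have -> : (a - e + #|A|.-1 - (a - r) = #|A|.-1 - (e - r))%N by lia.
  rewrite bin_sub; last by lia.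
  by rewrite mulrCA -natrM; congr (_ * _%:R); rewrite mulnC mulnA.
rewrite [RHS](reindex_inj rev_ord_inj) /= -big_mkcond /=.
pose G r : int :=
  (-1) ^+ (e - r) * ('C(#|A|.-1, e - r) * 'C(a, r) * 'C(b, r))%:R.
transitivity (\sum_(r < e.+1) G r); first by rewrite (big_ord_widen a.+1).
by apply: eq_bigr => r _; rewrite /lloyd_term subSS subKn // -ltnS.
Qed.

(** * Functions annihilated by the ball relation *)

Definition trace_sum n w (f : {set 'I_n} -> int) (A I : {set 'I_n}) : int :=
  \sum_(Y in johnson n w | Y :&: A == I) f Y.

Lemma trace_sum_split n w f (A I : {set 'I_n}) x : x \in A :\: I ->
  trace_sum w f A I + trace_sum w f A (x |: I) = trace_sum w f (A :\ x) I.
Proof.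
rewrite inE => /andP[I'x Ax].
rewrite [RHS](bigID (fun Y : {set 'I_n} => x \in Y)) /= [LHS]addrC.
congr (_ + _); apply: eq_bigl => Y; rewrite -andbA; congr (_ && _);
  rewrite setIDA.
  apply/eqP/andP => [eqYA | [/eqP <- Yx]]; last by rewrite setD1K // inE Yx.
  have : x \in Y :&: A by rewrite eqYA setU11.
  by rewrite inE eqYA setU1K // => /andP[->].
apply/eqP/andP => [eqYA | [/eqP <- Y'x]].
  have := I'x; rewrite -{1}eqYA inE Ax andbT => Y'x; split=> //.
  by rewrite eqYA (setDidPl _) // disjoint_sym disjoints1.
by rewrite (setDidPl _) // disjoint_sym disjoints1 inE (negPf Y'x).
Qed.

(** By [trace_sum_split], adding to I a point of A changes the sign. *)
Lemma trace_sum_sign n w f (A I : {set 'I_n}) :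
    (forall (x : 'I_n) (J : {set 'I_n}), x \in A -> J \subset A :\ x ->
       trace_sum w f (A :\ x) J = 0) ->
    I \subset A ->
  trace_sum w f A I = (-1) ^+ #|A :\: I| * trace_sum w f A A.
Proof.
move=> below; move def_d: #|A :\: I| => d.
elim: d I def_d => [|d IHd] I def_d sIA.
  have /eqP -> : I == A by rewrite eqEsubset sIA -setD_eq0 -cards_eq0 def_d.
  by rewrite expr0 mul1r.
have [x AI'x] : exists x, x \in A :\: I by apply/card_gt0P; rewrite def_d.
have [I'x Ax] : x \notin I /\ x \in A by apply/andP; rewrite -in_setD.
have sIAx : I \subset A :\ x by rewrite subsetD1 sIA.
have card_d : #|A :\: (x |: I)| = d.
  by move: def_d; rewrite setUC -setDDl (cardsD1 x) AI'x => -[].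
have sxIA : x |: I \subset A by rewrite subUset sub1set Ax.
apply/eqP; rewrite exprS mulN1r mulNr -addr_eq0 -(IHd _ card_d sxIA).
by rewrite trace_sum_split // below.
Qed.

(** The w-sets X that contain A and lie in the ball around Y are as many for
    all Y with the same number of points in A. *)
Lemma sum_ball_sums n w e f (A : {set 'I_n}) :
    (2 * w <= n)%N -> (#|A| <= w)%N ->
  \sum_(X in johnson n w | A \subset X)
     \sum_(Y in johnson n w) (jdist Y X <= e)%:R * f Y
  = \sum_(I : {set 'I_n} | I \subset A)
     ball_count n w e #|A| #|I| * trace_sum w f A I.
Proof.
move=> le_2wn le_Aw; rewrite exchange_big /=.
rewrite (partition_big (fun Y => Y :&: A)
  (fun I : {set 'I_n} => I \subset A)) /=; last first.
  by move=> Y _; apply: subsetIr.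
apply: eq_bigr => I _; rewrite mulr_sumr; apply: eq_bigr => Y /andP[JY /eqP <-].
by rewrite -mulr_suml ball_countP // setIC.
Qed.

(** Induction on |A|.  The ball sums of f above A add up to 0, and by
    [trace_sum_sign] and [ball_eigenvalue] also to a nonzero eigenvalue times
    [trace_sum w f A A].  For A empty this eigenvalue is the size of a ball. *)
Lemma trace_sum_eq0 n w e f (A I : {set 'I_n}) :
    (2 * w <= n)%N -> (#|A| <= w)%N -> (e <= w - #|A|)%N ->
    ball_count n w e 0 0 != 0 ->
    (forall k, (0 < k <= #|A|)%N ->
      lloyd_sum k.-1 (w - k) (n - w - k) e != 0) ->
    {in johnson n w, forall X,
       \sum_(Y in johnson n w) (jdist Y X <= e)%:R * f Y = 0} ->
  I \subset A -> trace_sum w f A I = 0.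
Proof.
move=> le_2wn; move def_k: #|A| => k.
elim: k A I def_k => [|k IHk] A I card_A le_kw le_ek s_neq0 eig_neq0 ball0 sIA.
  have := sum_ball_sums e f le_2wn (A := A); rewrite card_A => /(_ isT).
  rewrite big1 => [|X /andP[JX _]]; last exact: ball0.
  move/cards0_eq in card_A; rewrite card_A in sIA *.
  rewrite (big_pred1 set0) => [|J]; last by rewrite subset0.
  move/eqP; rewrite cards0 eq_sym mulf_eq0 (negPf s_neq0) /= => /eqP.
  by move: sIA; rewrite subset0 => /eqP->.
have sgn (J : {set 'I_n}) : J \subset A ->
    trace_sum w f A J = (-1) ^+ #|A :\: J| * trace_sum w f A A.
  apply: trace_sum_sign => x K Ax sKA; apply: IHk => //.
  - by have := cardsD1 x A; rewrite Ax card_A => -[].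
  - exact: ltnW.
  - by rewrite (leq_trans le_ek) // leq_sub2l.
  - by move=> j /andP[j_gt0 le_jk]; apply: eig_neq0; rewrite j_gt0 ltnW.
suff tA0 : trace_sum w f A A = 0 by rewrite sgn // tA0 mulr0.
have := sum_ball_sums e f le_2wn (A := A); rewrite card_A => /(_ le_kw).
rewrite big1 => [|X /andP[JX _]]; last exact: ball0.
under eq_bigr => J sJA do rewrite sgn // mulrA [_ * (_ ^+ _)]mulrC.
rewrite -mulr_suml => /esym/eqP; rewrite mulf_eq0 => /orP[|/eqP//].
have := ball_eigenvalue n (e := e) (w := w) (A := A); rewrite card_A => -> //.
by rewrite (negPf (eig_neq0 k.+1 _)) ?leqnn.
Qed.

(** * Regularity of perfect codes *)

Lemma card_johnson_trace n w (A I : {set 'I_n}) : I \subset A -> (#|I| <= w)%N ->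
  #|[set Y in johnson n w | Y :&: A == I]| = 'C(n - #|A|, w - #|I|).
Proof.
move=> sIA le_Iw.
have -> : (n - #|A|)%N = #|~: A| by rewrite [RHS]cardsCs setCK card_ord.
have disjI (Z : {set 'I_n}) : Z \subset ~: A -> I :&: Z = set0.
  move=> sZA; apply/eqP; rewrite setI_eq0 disjoints_subset.
  by rewrite (subset_trans sIA) // -setCS setCK.
rewrite -cards_draws -[RHS](card_in_imset (f := fun Z => I :|: Z)); last first.
  move=> Z1 Z2; rewrite !inE => /andP[sZ1 _] /andP[sZ2 _].
  move/(congr1 (fun B => B :\: I)).
  by rewrite !setDUl !setDv !set0U !(setDidPl _) // disjoint_sym -setI_eq0 disjI.
congr #|pred_of_set _|; apply/setP=> Y; rewrite !inE; apply/andP/imsetP.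
  case=> /eqP card_Y /eqP YA; exists (Y :\: A); last by rewrite -YA setID.
  rewrite inE subsetDr /=.
  by have := cardsID A Y; rewrite YA card_Y => <-; rewrite addKn.
case=> Z; rewrite inE => /andP[sZA /eqP card_Z] ->.
rewrite cardsU disjI // cards0 subn0 card_Z subnKC // eqxx; split=> //.
rewrite setIUl (setIidPl sIA); have -> : Z :&: A = set0; last by rewrite setU0.
by apply/eqP; rewrite setI_eq0 disjoints_subset.
Qed.

(** There are C(t,i) sets I of size i in A, whence
    alpha(i) = C(t,i) beta(i), with the same beta for all A. *)
Lemma regular_of_trace n w t s (C : {set {set 'I_n}}) : (t <= w)%N -> (0 < s)%N ->
    (forall A I : {set 'I_n}, #|A| = t -> I \subset A ->
       s * trace_meet C A I = 'C(n - t, w - #|I|))%N ->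
  regular_code t C.
Proof.
move=> le_tw s_gt0 traceE.
pose beta i := ('C(n - t, w - i) %/ s)%N.
have trace_beta (A I : {set 'I_n}) :
    #|A| = t -> I \subset A -> trace_meet C A I = beta #|I|.
  by move=> card_A sIA; rewrite /beta -(traceE A I) // mulKn.
split; last by move=> A card_A; exists beta => I; apply: trace_beta.
exists (fun i => 'C(t, i) * beta i)%N => A card_A i _.
rewrite -card_A -cards_draws /card_meet -sum1_card -sum_nat_const.
rewrite (partition_big (fun c => c :&: A)
  (fun I => I \in [set I : {set 'I_n} | I \subset A & #|I| == i])) /=; last first.
  by move=> c; rewrite !inE subsetIr => /andP[_ ->].
apply: eq_bigr => I; rewrite inE => /andP[sIA /eqP card_I].
rewrite -card_I -(trace_beta A) // /trace_meet -sum1_card; apply: eq_bigl => c.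
rewrite !inE -andbA; case: (c :&: A =P I) => [->|_]; last by rewrite !andbF.
by rewrite card_I eqxx.
Qed.

Lemma regular_code0 n (C : {set {set 'I_n}}) : regular_code 0 C.
Proof.
have trace0 (I : {set 'I_n}) : I \subset set0 -> trace_meet C set0 I = #|C|.
  rewrite subset0 => /eqP ->; apply: eq_card => c.
  by rewrite inE setI0 eqxx andbT.
split; last by move=> A /cards0_eq->; exists (fun=> #|C|).
exists (fun=> #|C|) => A /cards0_eq-> [] // _; apply: eq_card => c.
by rewrite inE setI0 cards0 eqxx andbT.
Qed.

Lemma ball_size n w e (X : {set 'I_n}) : (2 * w <= n)%N -> X \in johnson n w ->
  \sum_(Y in johnson n w) (jdist Y X <= e)%:R = ball_count n w e 0 0.
Proof.
move=> le_2wn JX; have := ball_countP e (A := set0) le_2wn _ JX.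
rewrite set0I cards0 /ball_count => <- //.
rewrite big_mkcondr /=; apply: eq_big => [Y|Y]; rewrite ?sub0set ?inE //.
rewrite !inE in JX *; move=> /eqP card_Y; congr (_ <= _)%N%:R.
by rewrite /jdist !cardsD card_Y (eqP JX) setIC.
Qed.

Lemma ball_size_gt0 n w e : (2 * w <= n)%N -> 0 < ball_count n w e 0 0.
Proof.
move=> le_2wn; have [X JX] : exists X, X \in johnson n w.
  apply/card_gt0P; rewrite -[johnson n w]setIT.
  have := cards_draws [set: 'I_n] w; rewrite cardsT card_ord => cardJ.
  have -> : johnson n w :&: setT
      = [set A : {set 'I_n} | A \subset [set: 'I_n] & #|A| == w].
    by apply/setP => A; rewrite !inE subsetT andbT.
  by rewrite cardJ bin_gt0; lia.
rewrite -(ball_size e le_2wn JX) (bigD1 X) //= /jdist setDv cards0 leq0n.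
by rewrite ltr_wpDr ?ltr01 // sumr_ge0.
Qed.

(** Each w-set lies in exactly one ball around a codeword, so the ball sums of
    s 1_C - 1 are s - s = 0 and [trace_sum_eq0] applies: up to the factor s,
    the code has as many members with trace I on A as there are w-sets. *)
Lemma perfect_trace n w e (C : {set {set 'I_n}}) (A I : {set 'I_n}) :
    (2 * w <= n)%N -> perfect_code w e C -> (#|A| <= w)%N -> (e <= w - #|A|)%N ->
    (forall k, (0 < k <= #|A|)%N ->
      lloyd_sum k.-1 (w - k) (n - w - k) e != 0) ->
    I \subset A ->
  ball_count n w e 0 0 * (trace_meet C A I)%:R = ('C(n - #|A|, w - #|I|))%:R.
Proof.
move=> le_2wn [sCJ coverJ disjC] le_Aw le_eA eig_neq0 sIA.
set s := ball_count _ _ _ _ _.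
pose f (Y : {set 'I_n}) : int := s * (Y \in C)%:R - 1.
have ball0 : {in johnson n w, forall X,
    \sum_(Y in johnson n w) (jdist Y X <= e)%:R * f Y = 0}.
  move=> X JX; under eq_bigr => Y _ do rewrite mulrBr mulr1 mulrCA.
  rewrite sumrB ball_size // -mulr_sumr -/s; apply/eqP; rewrite subr_eq0; apply/eqP.
  have /bigcupP[c Cc Xc] : X \in \bigcup_(c in C) jball w e c by rewrite coverJ.
  have Jc := subsetP sCJ c Cc.
  rewrite (bigD1 c) //= Cc big1 => [|Y /andP[JY neq_Yc]].
    by move: Xc; rewrite inE JX /= => ->; rewrite addr0 !mulr1.
  case CY: (Y \in C); last by rewrite mulr0.
  have /disjointFl := disjC Y c CY Cc neq_Yc.
  by move=> /(_ X Xc); rewrite inE JX /= => ->; rewrite mul0r.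
have s_neq0 := lt0r_neq0 (ball_size_gt0 e le_2wn).
have := trace_sum_eq0 le_2wn le_Aw le_eA s_neq0 eig_neq0 ball0 sIA.
rewrite /trace_sum sumrB -mulr_sumr => /eqP; rewrite subr_eq0 => /eqP.
rewrite -card_johnson_trace //; last by rewrite (leq_trans _ le_Aw) ?subset_leq_card.
rewrite /trace_meet -!sum1_card !natr_sum => E.
rewrite [RHS](eq_bigl (fun Y => (Y \in johnson n w) && (Y :&: A == I)));
  last by move=> Y; rewrite inE.
rewrite -E; congr (_ * _); rewrite big_mkcond [RHS]big_mkcond.
apply: eq_bigr => Y _ /=.
rewrite inE; case CY: (Y \in C) => /=; last by case: ifP.
by rewrite (subsetP sCJ Y CY).
Qed.

Local Close Scope ring_scope.

(* Num.truncn is the floor on nonnegative reals.  The subtraction on nat is   *)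
(* truncated: were the floor to exceed w, the conclusion would be             *)
(* 0-regularity, which every code satisfies.                                  *)
Theorem theorem3p1 (R : archiRcfType) (n w e : nat) (C : {set {set 'I_n}}) :
  2 * w <= n -> 2 <= 2 * w -> 2 <= e ->
  perfect_code w e C -> ~ trivial_code w e C ->
  regular_code (w - Num.truncn (e%:R * Num.sqrt (w%:R : R))%R) C.
Proof.
move=> le_2wn w2_gt1 e_ge2 perfC _.
have w_gt0 : 0 < w by rewrite -(ltn_pmul2l (isT : 0 < 2)) muln0 ltnW.
have := truncn_sqrt_bound R e w; have := truncn_sqrt_ge R e w_gt0.
move: (Num.truncn _) => F le_eF lt_F.
have [le_wF | lt_Fw] := leqP w F.
  by rewrite (eqP le_wF); apply: regular_code0.
have s_gt0 := ball_size_gt0 e le_2wn.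
have eig_neq0 (k : nat) : 0 < k <= w - F ->
    (lloyd_sum k.-1 (w - k) (n - w - k) e != 0)%R.
  case/andP=> k_gt0 le_kt; have le_Fa : F <= w - k by lia.
  have le_ea := leq_trans le_eF le_Fa.
  apply/lt0r_neq0/lloyd_sum_gt0; [by rewrite ltnW | lia |].
  have lt_a : e ^ 2 * w < (w - k).+1 ^ 2.
    by rewrite (leq_trans lt_F) // leq_sqr.
  (* The number q = w - k + 1 exceeds e sqrt w, and w - q = k - 1. *)
  have := sqr_bound e_ge2 (le_ea : e < (w - k).+1) lt_a.
  by rewrite subSn // subnS subKn; last lia.
apply: (@regular_of_trace n w _ `|ball_count n w e 0 0|%N).
- exact: leq_subr.
- by rewrite absz_gt0 gt_eqF.
move=> A I card_A sIA; apply/eqP; rewrite -eqz_nat PoszM gtz0_abs // -card_A.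
apply/eqP; rewrite -!natz; apply: perfect_trace; rewrite ?card_A ?leq_subr //.
by rewrite subKn // ltnW.
Qed.
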